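(* Let $m\le n$, $K\in\{0,\ldots,m-1\}$, $\gamma>0$, and let $\mathcal{C}\subset\mathbb{R}^{m\times n}$ satisfy condition (C1) and $-X\in\mathcal F(X;\mathcal C)$ for every $X\in\mathcal C$. Let $b\in\mathbb{R}^p$, $A_1,\ldots,A_p\in\mathbb{R}^{m\times n}$, $\mathcal{A}(X)=(A_1\bullet X,\ldots,A_p\bullet X)^\top$, and $f(X)=\frac12\|\mathcal A(X)-b\|_2^2$. Then every d-stationary point $X^*$ of $\min_X f(X)+\gamma\mathcal{T}_K(X)+\delta_{\mathcal C}(X)$ satisfies $\mathcal{T}_K(X^* )=0$ provided $$\gamma>\|\mathcal{A}^*\|_{2,2}\|b\|_2,$$ where $\mathcal{A}^*(y)=\sum_{i=1}^py_iA_i$ is the adjoint of $\mathcal A$ and $\|\mathcal{A}^*\|_{2,2}=\sup_{\|y\|_2=1}\|\mathcal{A}^*(y)\|_2$ with $\|\cdot\|_2$ the spectral norm on matrices.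
   Context: $X\bullet Y=\mathrm{tr}(X^\top Y)$. $\mathcal{T}_K(X)=\sum_{i=K+1}^{\min\{m,n\}}\sigma_i(X)$ (singular values in decreasing order). $\delta_{\mathcal C}$ = indicator of $\mathcal C$. Feasible cone $\mathcal{F}(X;\mathcal{C})=\{D\mid \exists\varsigma'>0:\ X+\varsigma D\in\mathcal{C}\ \forall\varsigma\in(0,\varsigma')\}$. Condition (C1): every $X\in\mathcal C$ has an SVD $X=U[\mathrm{diag}(\sigma_1(X),\ldots,\sigma_m(X)),0]V^\top$ with $-U[\mathrm{diag}(0,\ldots,0,\sigma_{K+1}(X),\ldots,\sigma_m(X)),0]V^\top\in\mathcal{F}(X;\mathcal C)$. $X^*\in\mathcal C$ is d-stationary if the objective's directional derivative at $X^*$ is $\ge0$ for all $D\in\mathcal F(X^*;\mathcal C)$. *)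

(* Defs.v *)
From HB Require Import structures.
From mathcomp Require Import all_boot all_order all_algebra.
From mathcomp Require Import all_classical all_reals all_analysis.
From Stdlib Require Import ClassicalEpsilon.
Set Implicit Arguments. Unset Strict Implicit. Unset Printing Implicit Defensive.
Import Order.TTheory GRing.Theory Num.Theory.
Import numFieldNormedType.Exports.
Local Open Scope classical_set_scope.
Local Open Scope ring_scope.

Section Defs.
Variable R : realType.

Definition diagmn (m n : nat) (s : 'I_m -> R) : 'M[R]_(m, n) :=
  \matrix_(i < m, j < n) (if (i : nat) == (j : nat) then s i else 0).

Definition is_svd (m n : nat) (X : 'M[R]_(m, n)) (U : 'M[R]_m) (s : 'I_m -> R)
    (V : 'M[R]_n) : Prop :=
  [/\ U^T *m U = 1%:M, V^T *m V = 1%:M,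
      (forall i : 'I_m, 0 <= s i),
      (forall i j : 'I_m, (i <= j)%N -> s j <= s i)
    & X = U *m diagmn n s *m V^T].

Definition sv (m n : nat) (X : 'M[R]_(m, n)) : 'I_m -> R :=
  epsilon (inhabits (fun _ => 0))
    (fun s => exists U V, is_svd X U s V).

(* T_K(X) = sum_{i = K+1}^{m} sigma_i(X)  (1-based), i.e. 0-based indices i >= K *)
Definition TK (m n : nat) (K : nat) (X : 'M[R]_(m, n)) : R :=
  \sum_(i < m | (K <= i)%N) sv X i.

Definition specnorm (m n : nat) (X : 'M[R]_(m, n)) : R :=
  \big[Num.max/0]_(i < m) sv X i.

Definition vnorm (p : nat) (y : 'cV[R]_p) : R := Num.sqrt (\sum_(i < p) y i 0 ^+ 2).

Definition frob_inner (m n : nat) (X Y : 'M[R]_(m, n)) : R := \tr (X^T *m Y).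

Definition Aop (m n p : nat) (A : 'I_p -> 'M[R]_(m, n)) (X : 'M[R]_(m, n)) : 'cV[R]_p :=
  \col_(i < p) frob_inner (A i) X.

Definition Aadj (m n p : nat) (A : 'I_p -> 'M[R]_(m, n)) (y : 'cV[R]_p) : 'M[R]_(m, n) :=
  \sum_(i < p) y i 0 *: A i.

Definition adjnorm (m n p : nat) (A : 'I_p -> 'M[R]_(m, n)) : R :=
  sup [set specnorm (Aadj A y) | y in [set y : 'cV[R]_p | vnorm y = 1]].

Definition lsq (m n p : nat) (A : 'I_p -> 'M[R]_(m, n)) (b : 'cV[R]_p)
    (X : 'M[R]_(m, n)) : R :=
  2^-1 * vnorm (Aop A X - b) ^+ 2.

Definition feasible (m n : nat) (C : set 'M[R]_(m, n)) (X D : 'M[R]_(m, n)) : Prop :=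
  exists2 s' : R, 0 < s' & forall t : R, 0 < t -> t < s' -> C (X + t *: D).

Definition C1 (m n : nat) (K : nat) (C : set 'M[R]_(m, n)) : Prop :=
  forall X, C X -> exists U V, is_svd X U (sv X) V /\
    feasible C X (- (U *m diagmn n (fun i : 'I_m => if (K <= i)%N then sv X i else 0) *m V^T)).

(* d-stationarity of X* for  min phi(X) + delta_C(X)  with phi real-valued:
   X* in C and for every feasible direction D the one-sided directional
   derivative lim_{t -> 0+} (phi(X*+tD) - phi(X* )) / t exists and is >= 0.
   (For D feasible, delta_C(X*+tD) = 0 for small t > 0.) *)
Definition dstationary (m n : nat) (phi : 'M[R]_(m, n) -> R) (C : set 'M[R]_(m, n))
    (Xs : 'M[R]_(m, n)) : Prop :=
  C Xs /\ forall D, feasible C Xs D ->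
    exists2 L : R,
      (fun t : R => (phi (Xs + t *: D) - phi Xs) / t) x @[x --> 0^'+] --> L
      & 0 <= L.

End Defs.

(* Main.v *)
(** Singular values behave as expected: an SVD exists, by maximizing the bilinear
form [x Y y^T] over unit vectors and deflating with Householder reflections,
and the values are unique because [X X^T] has characteristic polynomial
[\prod_i ('X - (s i ^+ 2)%:P)].

Along each of the directions [- Xs] and minus the tail of the SVD of [Xs], the
tail sum is scaled by [1 - t], so its derivative is [- TK K Xs]. Stationarity
along [- Xs] gives [<A Xs - b, A Xs> <= 0], hence [|A Xs - b| <= |b|].
Stationarity along the tail and the duality between spectral and nuclear norms
then give [gamma * TK K Xs <= adjnorm A * |b| * TK K Xs]. *)

Require Import Defs.
From HB Require Import structures.
From mathcomp Require Import all_boot all_order all_algebra.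
From mathcomp Require Import all_classical all_reals all_analysis.
From mathcomp Require Import ring lra.
Import Order.TTheory GRing.Theory Num.Theory.
Import numFieldNormedType.Exports.
Local Open Scope classical_set_scope.
Local Open Scope ring_scope.

Set Implicit Arguments. Unset Strict Implicit. Unset Printing Implicit Defensive.

Section SingularValues.
Variable R : realType.
Implicit Types m n p : nat.

(** * Inner product of row vectors and Householder reflections *)

Definition dot n (x y : 'rV[R]_n) : R := (x *m y^T) 0 0.

Lemma dotE n (x y : 'rV[R]_n) : dot x y = \sum_i x 0 i * y 0 i.
Proof. by rewrite /dot mxE; apply: eq_bigr => i _; rewrite mxE. Qed.

Lemma dot_sqr n (x : 'rV[R]_n) : dot x x = \sum_i x 0 i ^+ 2.
Proof. by rewrite dotE; apply: eq_bigr => i _; rewrite expr2. Qed.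

Lemma dotC n (x y : 'rV[R]_n) : dot x y = dot y x.
Proof. by rewrite !dotE; apply: eq_bigr => i _; rewrite mulrC. Qed.

Lemma dotDl n (x y z : 'rV[R]_n) : dot (x + y) z = dot x z + dot y z.
Proof. by rewrite /dot mulmxDl mxE. Qed.

Lemma dotZl n a (x z : 'rV[R]_n) : dot (a *: x) z = a * dot x z.
Proof. by rewrite /dot -scalemxAl mxE. Qed.

Lemma dotDr n (x y z : 'rV[R]_n) : dot z (x + y) = dot z x + dot z y.
Proof. by rewrite !(dotC z) dotDl. Qed.

Lemma dotZr n a (x z : 'rV[R]_n) : dot z (a *: x) = a * dot z x.
Proof. by rewrite !(dotC z) dotZl. Qed.

Lemma dot_ge0 n (x : 'rV[R]_n) : 0 <= dot x x.
Proof. by rewrite dot_sqr sumr_ge0 // => i _; rewrite sqr_ge0. Qed.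

Lemma dot_eq0 n (x : 'rV[R]_n) : dot x x <= 0 -> x = 0.
Proof.
move=> x0; apply/rowP => i; rewrite mxE.
have : dot x x == 0 by rewrite eq_le x0 dot_ge0.
rewrite dot_sqr psumr_eq0; last by move=> j _; rewrite sqr_ge0.
by move=> /allP /(_ i (mem_index_enum _)); rewrite sqrf_eq0 => /eqP.
Qed.

Lemma dot_mulmx m n (x : 'rV[R]_m) (M : 'M[R]_(m, n)) y :
  dot (x *m M) y = dot x (y *m M^T).
Proof. by rewrite /dot trmx_mul trmxK mulmxA. Qed.

Lemma dot_orth n (Q : 'M[R]_n) x y :
  Q *m Q^T = 1%:M -> dot (x *m Q) (y *m Q) = dot x y.
Proof. by move=> Qo; rewrite dot_mulmx -mulmxA Qo mulmx1. Qed.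

(* Householder reflection exchanging the first basis vector and [u]. *)
Lemma orth_with_first_row n (u : 'rV[R]_n.+1) : dot u u = 1 ->
  exists2 Q : 'M[R]_n.+1, Q *m Q^T = 1%:M & delta_mx 0 0 *m Q = u.
Proof.
move=> u1; pose e : 'rV[R]_n.+1 := delta_mx 0 0.
have e1 : dot e e = 1.
  by rewrite /dot /e trmx_delta mul_delta_mx mxE eqxx.
have [->|une] := eqVneq u e.
  by exists 1%:M; rewrite ?trmx1 mulmx1.
pose w := u - e.
have w0 : dot w w != 0.
  apply: contra une => /eqP w0; rewrite -subr_eq0.
  by apply/eqP/dot_eq0; rewrite w0.
have wE : dot w w = 2 - 2 * dot e u.
  have -> : w = u + (-1) *: e by rewrite scaleN1r.
  by rewrite !(dotDl, dotDr, dotZl, dotZr) u1 e1 (dotC u); ring.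
have ew : dot e w = - (dot w w / 2).
  rewrite wE.
  have -> : w = u + (-1) *: e by rewrite scaleN1r.
  by rewrite dotDr dotZr e1; field.
have wwT : w *m w^T = (dot w w)%:M by rewrite [LHS]mx11_scalar.
pose c := 2 / dot w w.
exists (1%:M - c *: (w^T *m w)).
  have -> : (1%:M - c *: (w^T *m w))^T = 1%:M - c *: (w^T *m w).
    by rewrite linearB linearZ /= trmx1 trmx_mul trmxK.
  have MM : w^T *m w *m (w^T *m w) = dot w w *: (w^T *m w).
    by rewrite -mulmxA (mulmxA w) wwT mul_scalar_mx -scalemxAr.
  move: (w^T *m w) MM => M MM.
  rewrite mulmxBl !mulmxBr !mul1mx mulmx1 -scalemxAl -scalemxAr MM !scalerA.
  have -> : c * c * dot w w = c + c by rewrite /c; field.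
  by rewrite scalerDl opprB addrK subrK.
rewrite mulmxBr mulmx1 -scalemxAr mulmxA.
have -> : delta_mx 0 0 *m w^T = (dot e w)%:M by rewrite [LHS]mx11_scalar.
rewrite mul_scalar_mx scalerA ew /c.
have -> : 2 / dot w w * - (dot w w / 2) = -1 by field.
by rewrite scaleN1r opprK addrC subrK.
Qed.

(** The equality case of Cauchy-Schwarz. Testing [-u] gives [0 <= s], and testing the normalized [g]
    gives [|g| <= s]; then [|g - s u|^2 = |g|^2 - s^2 <= 0]. *)
Lemma eq_scale_of_dot_max n (g u : 'rV[R]_n) (s : R) :
  dot u u = 1 -> dot u g = s -> (forall x, dot x x = 1 -> dot x g <= s) ->
  g = s *: u.
Proof.
move=> u1 ug gmax.
have s0 : 0 <= s.
  have := gmax ((-1) *: u); rewrite dotZl dotZr u1 dotZl ug.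
  by move=> h; have := h _; lra.
have gg : dot g g <= s ^+ 2.
  have [->|g0] := eqVneq (dot g g) 0; first exact: sqr_ge0.
  have gp : 0 < dot g g by rewrite lt_def g0 dot_ge0.
  pose c := Num.sqrt (dot g g).
  have c0 : 0 < c by rewrite sqrtr_gt0.
  have cE : dot g g = c ^+ 2 by rewrite sqr_sqrtr // dot_ge0.
  have := gmax (c^-1 *: g); rewrite !(dotZl, dotZr) cE.
  have -> : c^-1 * (c^-1 * c ^+ 2) = 1 by field; rewrite gt_eqF.
  have -> : c^-1 * c ^+ 2 = c by field; rewrite gt_eqF.
  by move=> /(_ erefl) cs; rewrite ler_pXn2r // nnegrE ?ltW.
apply/eqP; rewrite -subr_eq0; apply/eqP/dot_eq0.
rewrite -scaleNr !(dotDl, dotDr, dotZl, dotZr) (dotC g u) ug u1; nra.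
Qed.

(** * Maximizing a bilinear form over unit spheres *)

Lemma continuous_bigsum (T : topologicalType) (I : finType) (F : I -> T -> R) :
  (forall i, continuous (F i)) -> continuous (fun x => \sum_i F i x).
Proof.
move=> cF x; apply: cvg_big => [|i _]; [exact: add_continuous|exact: cF].
Qed.

Lemma continuous_mul (T : topologicalType) (f g : T -> R) :
  continuous f -> continuous g -> continuous (fun x => f x * g x).
Proof. by move=> cf cg x; apply: cvgM; [apply: cf|apply: cg]. Qed.

Lemma unit_sphere_compact n : compact [set u : 'rV[R]_n | dot u u = 1].
Proof.
apply: bounded_closed_compact.
  exists 1; split => // M M1 u /= u1; rewrite /Num.norm/= mx_normrE.
  apply: bigmax_le => [|[i j] _ /=]; first lra.
  apply: le_trans (ltW M1); rewrite ord1.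
  rewrite -(@ler_pXn2r _ 2) // ?nnegrE // expr1n real_normK ?num_real //.
  by rewrite -u1 dot_sqr (bigD1 j) //= lerDl sumr_ge0 // => k _; rewrite sqr_ge0.
have -> : [set u : 'rV[R]_n | dot u u = 1] =
  (fun u : 'rV[R]_n => \sum_i u 0 i * u 0 i) @^-1` [set 1].
  by apply/seteqP; split => u /=; rewrite dotE.
apply: preimage_closed; last exact: closed_eq.
move=> u _; apply: continuous_bigsum => i; apply: continuous_mul.
all: exact: coord_continuous.
Qed.

(** A continuous function attains its maximum on the compact product of two spheres. Successor
    dimensions make both spheres nonempty. *)
Lemma bilinear_max m n (Y : 'M[R]_(m.+1, n.+1)) :
  exists u v, [/\ dot u u = 1, dot v v = 1 &
    forall x y, dot x x = 1 -> dot y y = 1 ->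
      dot (x *m Y) y <= dot (u *m Y) v].
Proof.
pose S := [set u : 'rV[R]_m.+1 | dot u u = 1] `*`
          [set v : 'rV[R]_n.+1 | dot v v = 1].
pose f (z : 'rV[R]_m.+1 * 'rV[R]_n.+1) : R :=
  \sum_j (\sum_i z.1 0 i * Y i j) * z.2 0 j.
have fE x y : f (x, y) = dot (x *m Y) y.
  by rewrite dotE /f; apply: eq_bigr => j _; rewrite mxE.
have d1 k : dot (delta_mx 0 0 : 'rV[R]_k.+1) (delta_mx 0 0) = 1.
  by rewrite /dot trmx_delta mul_delta_mx mxE eqxx.
have S0 : S !=set0 by exists (delta_mx 0 0, delta_mx 0 0); split; apply: d1.
have cS : compact S by apply: compact_setX; apply: unit_sphere_compact.
have cf : continuous f.
  apply: continuous_bigsum => j; apply: continuous_mul => [|z].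
    apply: continuous_bigsum => i; apply: continuous_mul => [z|z].
      apply: (@continuous_comp _ _ _ fst (fun u : 'rV[R]_m.+1 => u 0 i)).
        exact: cvg_fst.
      exact: coord_continuous.
    exact: cvg_cst.
  apply: (@continuous_comp _ _ _ snd (fun u : 'rV[R]_n.+1 => u 0 j)).
    exact: cvg_snd.
  exact: coord_continuous.
have [[u v] uvS fmax] := compact_EVT_max S0 cS (continuous_subspaceT cf).
move: uvS; rewrite inE => -[/= u1 v1].
exists u, v; split => // x y x1 y1.
by rewrite -!fE; apply: fmax; rewrite inE; split.
Qed.

(** * Existence of a singular value decomposition *)

(** Turns bounds on the bilinear form of [Y] at unit vectors into bounds on its singular values. *)
Lemma svd_entry m n (Y : 'M[R]_(m, n)) U s V (i : 'I_m) (j : 'I_n) :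
  is_svd Y U s V -> (i : nat) = j -> s i = dot (row i U^T *m Y) (row j V^T).
Proof.
move=> [UU VV _ _ ->] ij.
rewrite /dot tr_row trmxK colE mulmxA -colE -!row_mul !mulmxA UU mul1mx.
by rewrite -mulmxA VV mulmx1 !mxE ij eqxx.
Qed.

Lemma dot_row_orth m (U : 'M[R]_m) i : U^T *m U = 1%:M ->
  dot (row i U^T) (row i U^T) = 1.
Proof.
move=> UU; rewrite /dot tr_row trmxK colE mulmxA -colE -row_mul UU.
by rewrite !mxE eqxx.
Qed.

(** Induction on [m]. A maximizing pair satisfies [u Y = s0 v] and [v Y^T = s0 u], so rotating [u]
    and [v] to first basis vectors leaves [s0] in the corner, zeros beside it, and a smaller block
    to decompose. *)
Lemma svd_exists m n (Y : 'M[R]_(m, n)) : (m <= n)%N ->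
  exists U s V, is_svd Y U s V.
Proof.
elim: m n Y => [|m IH] n Y mn.
  exists 1%:M, (fun=> 0), 1%:M; split => //; rewrite ?trmx1 ?mulmx1 //.
  by apply/matrixP => -[].
case: n Y mn => // n Y; rewrite ltnS => mn.
have [u [v [u1 v1 uvmax]]] := bilinear_max Y.
set s0 := dot _ v in uvmax.
have s0_ge0 : 0 <= s0.
  have := uvmax ((-1) *: u) v; rewrite dotZl dotZr u1 -scalemxAl dotZl -/s0.
  by move=> h; have := h _ v1; lra.
have vY : v *m Y^T = s0 *: u.
  apply: eq_scale_of_dot_max => // [|x x1]; rewrite -dot_mulmx //.
  exact: uvmax.
have uY : u *m Y = s0 *: v.
  apply: eq_scale_of_dot_max => // [|y y1]; rewrite dotC //.
  exact: uvmax.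
have [P PP Pu] := orth_with_first_row u1.
have [Q QQ Qv] := orth_with_first_row v1.
(* The dimensions [1 + m] and [1 + n] give access to block operations, and the existential keeps the
   product opaque. *)
have [Z Zdef] : exists Z : 'M[R]_(1 + m, 1 + n), Z = P *m Y *m Q^T.
  by eexists.
pose Y' := drsubmx Z.
have ZE : Z = block_mx s0%:M 0 0 Y'.
  have r0 : row 0 Z = s0 *: delta_mx 0 0.
    rewrite Zdef !row_mul rowE Pu uY -scalemxAl -Qv -mulmxA QQ mulmx1 //.
  have c0 : row 0 Z^T = s0 *: delta_mx 0 0.
    rewrite Zdef !trmx_mul trmxK row_mul rowE Qv mulmxA vY -scalemxAl.
    by rewrite -Pu -mulmxA PP mulmx1.
  have r0E j : Z 0 j = s0 * (j == 0)%:R.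
    by move/rowP/(_ j): r0; rewrite !mxE.
  have c0E i : Z i 0 = s0 * (i == 0)%:R.
    by move/rowP/(_ i): c0; rewrite !mxE.
  have l0 k : lshift k (0 : 'I_1) = 0 :> 'I_(1 + k) by apply: val_inj.
  rewrite -[Z in LHS]submxK; congr block_mx; apply/matrixP => i j; rewrite !mxE.
  - by rewrite (ord1 i) (ord1 j) l0 r0E eqxx mulr1.
  - by rewrite (ord1 i) l0 r0E mulr0.
  - by rewrite (ord1 j) l0 c0E mulr0.
(* Padding with a leading zero preserves norms, so the maximum [s0] also bounds the form of the
   remaining block. This puts [s0] first in the decreasing order. *)
have Y'max a c : dot a a = 1 -> dot c c = 1 -> dot (a *m Y') c <= s0.
  move=> a1 c1.
  pose x : 'rV[R]_(1 + m) := row_mx 0 a; pose y : 'rV[R]_(1 + n) := row_mx 0 c.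
  have x1 : dot x x = 1.
    by rewrite /dot tr_row_mx mul_row_col mul0mx add0r.
  have y1 : dot y y = 1.
    by rewrite /dot tr_row_mx mul_row_col mul0mx add0r.
  have -> : dot (a *m Y') c = dot (x *m Z) y.
    rewrite ZE /dot mul_row_block !mul0mx !mulmx0 !add0r tr_row_mx.
    by rewrite mul_row_col trmx0 mulmx0 add0r.
  rewrite Zdef !mulmxA dot_mulmx trmxK.
  by apply: uvmax; rewrite dot_orth.
have [U' [s' [V' svd']]] := IH n Y' mn.
have [UU VV s'0 s'dec Y'E] := svd'.
have s'le j : s' j <= s0.
  rewrite (svd_entry (j := widen_ord mn j) svd') //.
  by apply: Y'max; apply: dot_row_orth.
pose s (i : 'I_(1 + m)) := match fintype.split i with inl _ => s0 | inr j => s' j end.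
have sE : diagmn (1 + n) s = block_mx s0%:M 0 0 (diagmn n s').
  apply/matrixP => i j; rewrite !mxE /s.
  case: splitP => i' iE; rewrite !mxE; case: splitP => j' jE;
    rewrite !mxE iE jE //.
  - by rewrite !ord1.
  - by rewrite ord1.
  - by rewrite ord1.
have orth_block k (M : 'M[R]_k) : M^T *m M = 1%:M ->
    (block_mx 1%:M 0 0 M)^T *m block_mx 1%:M 0 0 M = 1%:M :> 'M[R]_(1 + k).
  move=> MM; rewrite tr_block_mx !trmx0 trmx1 mulmx_block !mul0mx !mulmx0.
  by rewrite !addr0 mul1mx add0r MM -scalar_mx_block.
have [U [V [UTU VTV ZUV]]] : exists (U : 'M[R]_(1 + m)) (V : 'M[R]_(1 + n)),
    [/\ U^T *m U = 1%:M, V^T *m V = 1%:M & Z = U *m diagmn (1 + n) s *m V^T].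
  exists (block_mx 1%:M 0 0 U'), (block_mx 1%:M 0 0 V').
  split; [exact: orth_block|exact: orth_block|].
  rewrite ZE sE tr_block_mx !trmx0 trmx1 !mulmx_block.
  by rewrite !(mul0mx, mulmx0, addr0, add0r, mulmx1, mul1mx) -Y'E.
exists (P^T *m U), s, (Q^T *m V); split.
- by rewrite trmx_mul trmxK mulmxA -(mulmxA _ P) PP mulmx1.
- by rewrite trmx_mul trmxK mulmxA -(mulmxA _ Q) QQ mulmx1.
- by move=> i; rewrite /s; case: fintype.split.
- move=> i j ij; rewrite /s; case: splitP => j' jE; case: splitP => i' iE //.
    by rewrite jE iE (ord1 j') in ij.
  by apply: s'dec; rewrite jE iE leq_add2l in ij.
have -> : Y = P^T *m Z *m Q.
  by rewrite Zdef !mulmxA (mulmx1C PP) mul1mx -mulmxA (mulmx1C QQ) mulmx1.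
by rewrite ZUV trmx_mul trmxK !mulmxA.
Qed.

(** * Uniqueness of singular values *)

Lemma diagmn_mul_tr m n (s : 'I_m -> R) : (m <= n)%N ->
  diagmn n s *m (diagmn n s)^T = diag_mx (\row_i (s i ^+ 2)).
Proof.
move=> mn; apply/matrixP => i j; rewrite !mxE (bigD1 (widen_ord mn i)) //=.
rewrite !mxE /= eqxx big1 ?addr0 => [|k ki]; last first.
  rewrite !mxE; case: eqP => ik; last by rewrite mul0r.
  by case/eqP: ki; apply: val_inj.
have [->|ij] := eqVneq i j; first by rewrite !eqxx -expr2.
by rewrite ifN ?mulr0 // eq_sym.
Qed.

Lemma svd_unique m n (X : 'M[R]_(m, n)) U s V U' s' V' : (m <= n)%N ->
  is_svd X U s V -> is_svd X U' s' V' -> s = s'.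
Proof.
move=> mn.
have charE U1 s1 V1 : is_svd X U1 s1 V1 ->
    char_poly (X *m X^T) = \prod_(x <- [seq s1 i ^+ 2 | i <- enum 'I_m]) ('X - x%:P).
  move=> [UU VV _ _ ->].
  rewrite !trmx_mul trmxK !mulmxA -(mulmxA _ V1^T) VV mulmx1.
  rewrite -(mulmxA U1 (diagmn _ _)) diagmn_mul_tr // big_map big_enum /=.
  pose D := diag_mx (\row_i (s1 i ^+ 2)).
  have -> : char_poly (U1 *m D *m U1^T) = char_poly D.
    (* Lifted to polynomial entries, the orthogonal [U1] commutes with the scalar matrix ['X], so
       conjugation factors out of the determinant. *)
    pose f := map_mx (polyC : R -> {poly R}) : 'M[R]_m -> 'M[{poly R}]_m.
    have fUU : f U1 *m f U1^T = 1%:M.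
      by rewrite -map_mxM (mulmx1C UU) map_mx1.
    have -> : char_poly (U1 *m D *m U1^T) = \det (f U1 *m char_poly_mx D *m f U1^T).
      rewrite /char_poly; congr (\det _); rewrite /char_poly_mx !map_mxM /= -/f.
      by rewrite mulmxBr mulmxBl scalar_mxC -(mulmxA 'X%:M) fUU mulmx1.
    rewrite !det_mulmx mulrAC -det_mulmx fUU det1 mul1r //.
  rewrite char_poly_trig ?diag_mx_is_trig //.
  by apply: eq_bigr => i _; rewrite !mxE eqxx.
move=> h h'; have := charE _ _ _ h; rewrite (charE _ _ _ h') => /prod_XsubC_eq.
have sorted_sq U1 s1 V1 : is_svd X U1 s1 V1 ->
    sorted >=%R [seq s1 i ^+ 2 | i <- enum 'I_m].
  move=> [_ _ s0 sd _].
  rewrite sorted_map; apply: (@sub_sorted _ (relpre val leq)) => [i j /= ij|].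
    by rewrite ler_pXn2r ?nnegrE //; exact: sd.
  by rewrite -sorted_map val_enum_ord iota_sorted.
(* The roots agree only up to permutation. Both lists of squares are decreasing, hence equal, and
   nonnegativity removes the squares. *)
move=> /(sorted_eq ge_trans ge_anti (sorted_sq _ _ _ h') (sorted_sq _ _ _ h)).
move=> /eq_in_map ss; apply/funext => i.
case: h h' => _ _ s0 _ _ [_ _ s0' _ _].
have := ss i (mem_enum _ i).
by move=> /eqP; rewrite eqrXn2 // => /eqP.
Qed.

(** [sv] is an epsilon choice; existence of a decomposition is what gives it its defining
    property. *)
Lemma sv_svd m n (X : 'M[R]_(m, n)) : (m <= n)%N ->
  exists U V, is_svd X U (sv X) V.
Proof.
move=> mn; have [U [s [V h]]] := svd_exists X mn.
apply: (ClassicalEpsilon.epsilon_spec _ (fun s => exists U V, is_svd X U s V)).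
by exists s, U, V.
Qed.

(** Lets [sv] be read off any decomposition at hand, in particular that of a perturbed matrix. *)
Lemma svE m n (X : 'M[R]_(m, n)) U s V : (m <= n)%N ->
  is_svd X U s V -> sv X = s.
Proof.
move=> mn h; have [U' [V' h']] := sv_svd X mn.
exact: svd_unique h' h.
Qed.

(** * Spectral norm and its duality with the nuclear norm *)

Lemma sv_le_specnorm m n (X : 'M[R]_(m, n)) i : sv X i <= specnorm X.
Proof. exact: le_bigmax. Qed.

Lemma sum_widen_le m n (mn : (m <= n)%N) (F : 'I_n -> R) :
  (forall j, 0 <= F j) -> \sum_i F (widen_ord mn i) <= \sum_j F j.
Proof.
move=> F0.
have -> : \sum_i F (widen_ord mn i) = \sum_(j < n | (j < m)%N) F j.
  by rewrite (big_ord_narrow mn).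
by rewrite [leRHS](bigID (fun j : 'I_n => (j < m)%N)) /= lerDl sumr_ge0.
Qed.

(** In the singular bases the form is [\sum_i sv Y i * a_i * c_i] with [a], [c] unit vectors; bound
    [a_i * c_i] by [(a_i^2 + c_i^2) / 2] and [sv Y i] by the norm. *)
Lemma dot_le_specnorm m n (Y : 'M[R]_(m, n)) x y : (m <= n)%N ->
  dot x x = 1 -> dot y y = 1 -> dot (x *m Y) y <= specnorm Y.
Proof.
move=> mn x1 y1; have [U [V h]] := sv_svd Y mn.
have [UU VV s0 sd {1}->] := h.
pose a := x *m U; pose c := y *m V.
have a1 : dot a a = 1 by rewrite dot_orth // (mulmx1C UU).
have c1 : dot c c = 1 by rewrite dot_orth // (mulmx1C VV).
rewrite !mulmxA dot_mulmx trmxK -/a -/c; clearbody a c.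
have -> : dot (a *m diagmn n (sv Y)) c =
    \sum_i sv Y i * (a 0 i * c 0 (widen_ord mn i)).
  rewrite dot_mulmx dotE; apply: eq_bigr => i _; rewrite mxE.
  rewrite (bigD1 (widen_ord mn i)) //= !mxE eqxx big1 ?addr0 => [|j ji].
    by ring.
  rewrite !mxE; case: eqP => ij; last by rewrite mulr0.
  by case/eqP: ji; apply: val_inj.
have S0 : 0 <= specnorm Y by apply: bigmax_ge_id.
apply: (@le_trans _ _
  (\sum_i specnorm Y * ((a 0 i ^+ 2 + c 0 (widen_ord mn i) ^+ 2) / 2))).
  apply: ler_sum => i _.
  apply: (@le_trans _ _ (sv Y i * ((a 0 i ^+ 2 + c 0 (widen_ord mn i) ^+ 2) / 2))).
    apply: ler_wpM2l => //.
    by have := sqr_ge0 (a 0 i - c 0 (widen_ord mn i)); rewrite sqrrB; lra.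
  apply: ler_wpM2r; last exact: sv_le_specnorm.
  by rewrite divr_ge0 ?addr_ge0 ?sqr_ge0.
rewrite -mulr_sumr -[leRHS]mulr1 ler_wpM2l // -mulr_suml big_split /=.
have := @sum_widen_le _ _ mn (fun j => c 0 j ^+ 2) (fun j => sqr_ge0 _).
by rewrite -!dot_sqr a1 c1; lra.
Qed.

Lemma specnorm_ge0 m n (X : 'M[R]_(m, n)) : 0 <= specnorm X.
Proof. exact: bigmax_ge_id. Qed.

Lemma norm_dot_le_specnorm m n (Y : 'M[R]_(m, n)) x y : (m <= n)%N ->
  dot x x = 1 -> dot y y = 1 -> `|dot (x *m Y) y| <= specnorm Y.
Proof.
move=> mn x1 y1; rewrite ler_norml dot_le_specnorm // andbT lerNl.
have := @dot_le_specnorm _ _ Y ((-1) *: x) y mn.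
by rewrite dotZl dotZr -scalemxAl dotZl !mulN1r opprK; apply.
Qed.

Lemma frob_innerE m n (X Y : 'M[R]_(m, n)) :
  frob_inner X Y = \sum_j \sum_i X i j * Y i j.
Proof.
rewrite /frob_inner /mxtrace; apply: eq_bigr => j _; rewrite mxE.
by apply: eq_bigr => i _; rewrite mxE.
Qed.

(** Cyclicity of the trace moves [U] and [V] onto [Y]; pairing with a diagonal matrix then keeps
    only the diagonal entries of [U^T Y V]. *)
Lemma frob_inner_svd m n (Y : 'M[R]_(m, n)) U (w : 'I_m -> R) V
    (mn : (m <= n)%N) :
  frob_inner Y (U *m diagmn n w *m V^T) =
  \sum_i w i * dot (row i U^T *m Y) (row (widen_ord mn i) V^T).
Proof.
have -> : frob_inner Y (U *m diagmn n w *m V^T) =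
    frob_inner (U^T *m Y *m V) (diagmn n w).
  by rewrite /frob_inner mulmxA mxtrace_mulC !trmx_mul trmxK !mulmxA.
rewrite frob_innerE exchange_big /=; apply: eq_bigr => i _.
rewrite (bigD1 (widen_ord mn i)) //= big1 ?addr0 => [|j ji]; last first.
  rewrite [diagmn _ _ _ _]mxE; case: eqP => ij; last by rewrite mulr0.
  by case/eqP: ji; apply: val_inj.
rewrite [diagmn _ _ _ _]mxE /= eqxx mulrC; congr (_ * _).
by rewrite /dot tr_row trmxK colE mulmxA -colE -!row_mul [RHS]mxE [RHS]mxE.
Qed.

(** Each diagonal entry of [U^T Y V] is a value of the form of [Y] at unit vectors. The weights may
    come in any order, as the tail of a decomposition begins with zeros. *)
Lemma norm_frob_inner_le m n (Y : 'M[R]_(m, n)) U (w : 'I_m -> R) V :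
  (m <= n)%N -> U^T *m U = 1%:M -> V^T *m V = 1%:M -> (forall i, 0 <= w i) ->
  `|frob_inner Y (U *m diagmn n w *m V^T)| <= specnorm Y * \sum_i w i.
Proof.
move=> mn UU VV w0; rewrite (frob_inner_svd _ _ _ _ mn) mulr_sumr.
apply: le_trans (ler_norm_sum _ _ _) _; apply: ler_sum => i _.
rewrite normrM ger0_norm // mulrC ler_wpM2r //.
by apply: norm_dot_le_specnorm => //; apply: dot_row_orth.
Qed.

(** * The measurement operator and its adjoint norm *)

Lemma vnormE p (y : 'cV[R]_p) : vnorm y = Num.sqrt (dot y^T y^T).
Proof.
by rewrite dot_sqr; congr Num.sqrt; apply: eq_bigr => i _; rewrite mxE.
Qed.

Lemma vnorm_ge0 p (y : 'cV[R]_p) : 0 <= vnorm y.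
Proof. exact: sqrtr_ge0. Qed.

Lemma sqr_vnorm p (y : 'cV[R]_p) : vnorm y ^+ 2 = dot y^T y^T.
Proof. by rewrite vnormE sqr_sqrtr // dot_ge0. Qed.

Lemma frob_innerDr m n (X Y Z : 'M[R]_(m, n)) :
  frob_inner X (Y + Z) = frob_inner X Y + frob_inner X Z.
Proof. by rewrite /frob_inner mulmxDr mxtraceD. Qed.

Lemma frob_innerZr m n a (X Y : 'M[R]_(m, n)) :
  frob_inner X (a *: Y) = a * frob_inner X Y.
Proof. by rewrite /frob_inner -scalemxAr mxtraceZ. Qed.

Lemma AopD m n p (A : 'I_p -> 'M[R]_(m, n)) X Y :
  Aop A (X + Y) = Aop A X + Aop A Y.
Proof. by apply/colP => i; rewrite !mxE frob_innerDr. Qed.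

Lemma AopZ m n p (A : 'I_p -> 'M[R]_(m, n)) a X : Aop A (a *: X) = a *: Aop A X.
Proof. by apply/colP => i; rewrite !mxE frob_innerZr. Qed.

Lemma frob_inner_Aadj m n p (A : 'I_p -> 'M[R]_(m, n)) y X :
  frob_inner (Aadj A y) X = dot y^T (Aop A X)^T.
Proof.
rewrite dotE /frob_inner /Aadj raddf_sum mulmx_suml raddf_sum /=.
by apply: eq_bigr => i _; rewrite linearZ /= -scalemxAl mxtraceZ !mxE.
Qed.

(** Needed for [sup] to be an upper bound. A unit vector has entries of modulus at most 1, so the
    triangle inequality gives the bound [\sum_i specnorm (A i)]. *)
Lemma specnorm_Aadj_bounded m n p (A : 'I_p -> 'M[R]_(m, n)) : (m <= n)%N ->
  has_ubound [set specnorm (Aadj A y) | y in [set y | vnorm y = 1]].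
Proof.
move=> mn; exists (\sum_i specnorm (A i)) => _ [y /= y1 <-].
apply: bigmax_le => [|i _]; first by apply: sumr_ge0 => k _; apply: specnorm_ge0.
have [U [V h]] := sv_svd (Aadj A y) mn.
have [UU VV _ _ _] := h.
rewrite (svd_entry (j := widen_ord mn i) h) //.
set x := row _ _; set z := row _ _.
have x1 : dot x x = 1 by apply: dot_row_orth.
have z1 : dot z z = 1 by apply: dot_row_orth.
have -> : dot (x *m Aadj A y) z = \sum_k y k 0 * dot (x *m A k) z.
  rewrite /dot /Aadj mulmx_sumr mulmx_suml summxE.
  by apply: eq_bigr => k _; rewrite -scalemxAr -scalemxAl mxE.
apply: ler_sum => k _; apply: le_trans (ler_norm _) _; rewrite normrM.
apply: le_trans (norm_dot_le_specnorm (A k) mn x1 z1).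
rewrite ler_piMl //.
rewrite -(@ler_pXn2r _ 2) // ?nnegrE // expr1n real_normK ?num_real //.
have -> : 1 = vnorm y ^+ 2 by rewrite y1 expr1n.
rewrite sqr_vnorm dot_sqr (bigD1 k) //= mxE lerDl sumr_ge0 // => l _.
by rewrite sqr_ge0.
Qed.

Lemma adjnorm_ge0 m n p (A : 'I_p -> 'M[R]_(m, n)) : (m <= n)%N ->
  0 <= adjnorm A.
Proof.
move=> mn; rewrite /adjnorm; set S := (X in sup X).
(* When [p = 0] there is no unit vector, and the supremum of the empty set is 0 by convention. *)
have [->|/set0P[x Sx]] := eqVneq S set0; first by rewrite sup0.
apply: le_trans (ub_le_sup (specnorm_Aadj_bounded A mn) Sx).
by case: Sx => y _ <-; apply: specnorm_ge0.
Qed.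

(** Normalize [y], pass to the adjoint, and apply the duality bound to [Aadj A z] for the unit
    vector [z]. *)
Lemma norm_dot_le_adjnorm m n p (A : 'I_p -> 'M[R]_(m, n)) y U (w : 'I_m -> R) V :
  (m <= n)%N -> U^T *m U = 1%:M -> V^T *m V = 1%:M -> (forall i, 0 <= w i) ->
  `|dot y^T (Aop A (U *m diagmn n w *m V^T))^T| <=
  adjnorm A * vnorm y * \sum_i w i.
Proof.
move=> mn UU VV w0.
have w_ge0 : 0 <= \sum_i w i by apply: sumr_ge0.
have [y0|y0] := eqVneq (vnorm y) 0.
  have -> : y^T = 0 by apply: dot_eq0; rewrite -sqr_vnorm y0 expr0n.
  by rewrite y0 /dot mul0mx mxE normr0 mulr0 mul0r.
have yp : 0 < vnorm y by rewrite lt_def y0 vnorm_ge0.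
pose z := (vnorm y)^-1 *: y.
have yE : y = vnorm y *: z by rewrite scalerA divff // scale1r.
have z1 : vnorm z = 1.
  rewrite vnormE /z linearZ /= dotZl dotZr -sqr_vnorm.
  by rewrite mulrA -invfM -expr2 mulVf ?sqrf_eq0 // sqrtr1.
rewrite {1}yE linearZ /= dotZl normrM ger0_norm ?vnorm_ge0 //.
rewrite [adjnorm A * _]mulrC -mulrA ler_wpM2l ?vnorm_ge0 //.
rewrite -frob_inner_Aadj.
apply: le_trans (norm_frob_inner_le _ mn UU VV w0) _.
rewrite ler_wpM2r //; apply: ub_le_sup; first exact: specnorm_Aadj_bounded.
by exists z.
Qed.

(** * Directional derivatives of the objective *)

Lemma lsq_line m n p (A : 'I_p -> 'M[R]_(m, n)) b X D t :
  lsq A b (X + t *: D) = lsq A b X + t * dot (Aop A X - b)^T (Aop A D)^T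
    + t ^+ 2 / 2 * vnorm (Aop A D) ^+ 2.
Proof.
rewrite /lsq !sqr_vnorm AopD AopZ addrAC linearD linearZ /=.
set r := (_ - b)^T; set d := (Aop A D)^T.
by rewrite !(dotDl, dotDr, dotZl, dotZr) (dotC d r); field.
Qed.

(** When the tail sum scales by [1 - t], the difference quotient is affine in [t], and its value at
    0 must be the nonnegative limit [L]. *)
Lemma dstationary_ineq m n p K (gamma : R) (C : set 'M[R]_(m, n))
    (A : 'I_p -> 'M[R]_(m, n)) b X D :
  dstationary (fun X => lsq A b X + gamma * TK K X) C X ->
  feasible C X D ->
  (forall t, 0 < t -> t < 1 -> TK K (X + t *: D) = (1 - t) * TK K X) ->
  gamma * TK K X <= dot (Aop A X - b)^T (Aop A D)^T.
Proof.
move=> [_ st] /st[L cL L0] TKD.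
set a := dot _ _; set c := vnorm (Aop A D) ^+ 2 / 2.
suff -> : a = L + gamma * TK K X by rewrite lerDr.
apply/eqP; rewrite -subr_eq; apply/eqP.
(* [g] is the difference quotient for [0 < t < 1], extended continuously to 0. *)
pose g t := a - gamma * TK K X + t * c.
have cg : g t @[t --> 0^'+] --> a - gamma * TK K X.
  apply: cvg_at_right_filter.
  have -> : a - gamma * TK K X = g 0 by rewrite /g mul0r addr0.
  apply: cvgD; first exact: cvg_cst.
  by apply: cvgM; [exact: cvg_id|exact: cvg_cst].
apply: (cvg_unique _ cg) => //.
apply: cvg_trans cL; apply: near_eq_cvg; near=> t.
have t0 : 0 < t by near: t; exact: nbhs_right_gt.
have t1 : t < 1 by near: t; exact: nbhs_right_lt.
rewrite TKD // lsq_line /g /c -/a; field.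
by rewrite gt_eqF.
Unshelve. all: by end_near.
Qed.

End SingularValues.

(** * The two stationarity inequalities and the conclusion *)

Theorem mainTheorem17 (R : realType) (m n p K : nat) (gamma : R)
  (C : set 'M[R]_(m, n)) (A : 'I_p -> 'M[R]_(m, n)) (b : 'cV[R]_p)
  (Xs : 'M[R]_(m, n)) :
  (m <= n)%N -> (K < m)%N -> 0 < gamma ->
  C1 K C -> (forall X, C X -> feasible C X (- X)) ->
  adjnorm A * vnorm b < gamma ->
  dstationary (fun X => lsq A b X + gamma * TK K X) C Xs ->
  TK K Xs = 0.
Proof.
move=> mn _ gamma0 c1 Cneg gammaP st.
have CX : C Xs by case: st.
have [U [V [svdX tailF]]] := c1 _ CX.
have [UU VV s0 sdec XE] := svdX.
set w := (fun i : 'I_m => if (K <= i)%N then sv Xs i else 0) in tailF.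
have w0 i : 0 <= w i by rewrite /w; case: ifP.
have TKw : TK K Xs = \sum_i w i by rewrite /TK big_mkcond.
have TK0 : 0 <= TK K Xs by rewrite TKw sumr_ge0.
(* Covers both directions. Subtracting [t * e] keeps the singular values nonnegative and, by the
   third condition, ordered; so [U] and [V] still decompose the perturbed matrix, and its tail is
   scaled by [1 - t]. *)
have scaleTK (D : 'M[R]_(m, n)) (e : 'I_m -> R) :
    (forall i, 0 <= e i <= sv Xs i) ->
    (forall i : 'I_m, (K <= i)%N -> e i = sv Xs i) ->
    (forall t, 0 < t -> t < 1 -> forall i j : 'I_m, (i <= j)%N ->
       sv Xs j - t * e j <= sv Xs i - t * e i) ->
    D = - (U *m diagmn n e *m V^T) ->
    forall t, 0 < t -> t < 1 -> TK K (Xs + t *: D) = (1 - t) * TK K Xs.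
  move=> e0 eK edec -> t t0 t1.
  have svdt : is_svd (Xs + t *: - (U *m diagmn n e *m V^T)) U
      (fun i => sv Xs i - t * e i) V.
    split=> // [i|i j|].
    - by have := s0 i; have := e0 i; nra.
    - exact: edec.
    rewrite {1}XE scalerN scalemxAl scalemxAr -mulmxBl -mulmxBr.
    congr (_ *m _ *m _); apply/matrixP => i j; rewrite !mxE.
    by case: ifP => _ //; rewrite mulr0 subr0.
  rewrite /TK (svE mn svdt) mulr_sumr; apply: eq_bigr => i Ki.
  by rewrite eK //; ring.
have ineq1 : gamma * TK K Xs <= - dot (Aop A Xs - b)^T (Aop A Xs)^T.
  have : gamma * TK K Xs <= dot (Aop A Xs - b)^T (Aop A (- Xs))^T.
    apply: (dstationary_ineq st (Cneg _ CX)); apply: (scaleTK _ (sv Xs)) => //.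
    - by move=> i; rewrite s0 lexx.
    - by move=> t t0 t1 i j /sdec; nra.
    - by rewrite -XE.
  by rewrite -(scaleN1r Xs) AopZ linearZ /= dotZr mulN1r.
have ineq2 : gamma * TK K Xs <=
    - dot (Aop A Xs - b)^T (Aop A (U *m diagmn n w *m V^T))^T.
  have : gamma * TK K Xs <=
      dot (Aop A Xs - b)^T (Aop A (- (U *m diagmn n w *m V^T)))^T.
    apply: (dstationary_ineq st tailF); apply: (scaleTK _ w) => //.
    - by move=> i; rewrite w0 /= /w; case: ifP => _; rewrite ?lexx ?s0.
    - by move=> i Ki; rewrite /w Ki.
    (* Only tail values shrink, so the order survives; [i] in the tail with [j] in the head
       contradicts [i <= j]. *)
    - move=> t t0 t1 i j ij; rewrite /w.
      have := sdec i j ij; have := s0 i; have := s0 j.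
      case: ifP => Kj; case: ifP => Ki; try nra.
      by rewrite (leq_trans Ki ij) in Kj.
  by rewrite -(scaleN1r (_ *m _)) AopZ linearZ /= dotZr mulN1r.
(* With [q = A Xs], the first inequality gives [|q|^2 <= <b, q>], hence
   [|q - b|^2 <= |b|^2 - |q|^2]. *)
have rb : vnorm (Aop A Xs - b) <= vnorm b.
  rewrite -(@ler_pXn2r _ 2) // ?nnegrE ?vnorm_ge0 // !sqr_vnorm.
  have g0 : 0 <= gamma * TK K Xs by apply: mulr_ge0 => //; apply: ltW.
  move: ineq1; rewrite linearB /=; set q := (Aop A Xs)^T; set c := b^T.
  rewrite -(scaleN1r c) !(dotDl, dotDr, dotZl, dotZr) (dotC c q).
  have := dot_ge0 q; lra.
have main : gamma * TK K Xs <= adjnorm A * vnorm b * TK K Xs.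
  apply: (le_trans ineq2); apply: le_trans (ler_norm _) _; rewrite normrN.
  apply: le_trans (norm_dot_le_adjnorm _ _ mn UU VV w0) _.
  by rewrite -TKw ler_wpM2r // ler_wpM2l // adjnorm_ge0.
(* A positive tail sum could be cancelled from [main], contradicting the bound on [gamma]. *)
move: TK0; rewrite le_eqVlt => /orP[/eqP <- //|TKp].
by move: main; rewrite ler_pM2r // leNgt gammaP.
Qed.
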